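(* Let $\mathbb P=(P,\le,\Delta,f)$ be the syntactic forcing property over an at most countable transition-algebra signature $\Sigma$. For all conditions $p\in P$ and all sentences $\phi\in\mathrm{Sen}(\Delta_p)$: $p\Vdash^w\phi$ if and only if $\Gamma_p\vdash_{\Delta_p}\phi$.
   Context: Transition algebra (TA). A signature $\Sigma=(S,F\supseteq M,L)$ consists of sorts $S$, function symbols $F$ (constants have empty arity), monotonic function symbols $M\subseteq F$ and transition labels $L$; it is at most countable if $S,F,L$ are. Actions: $\mathfrak a::=\lambda\mid\mathfrak a\mathbin{;}\mathfrak a\mid\mathfrak a\cup\mathfrak a\mid\mathfrak a^*$ ($\lambda\in L$); $\mathfrak a^n$ is the $n$-fold composition (for $n=0$, $t_1\stackrel{\mathfrak a^0}\Rightarrow t_2$ is read as $t_1=t_2$). $\Sigma$-sentences: $\phi::=t_1=t_2\mid t_1\stackrel{\mathfrak a}\Rightarrow t_2\mid\neg\phi\mid\bigvee\Phi\mid\exists X\,\phi'$ (ground terms of equal sort, finite $\Phi$, finite variable set $X$ added as new constants giving $\Sigma[X]$, $\phi'\in\mathrm{Sen}(\Sigma[X])$); $\bot:=\bigvee\emptyset$. $T_\Sigma$: ground terms; substitutions $\theta\colon X\to T_\Sigma$ act on sentences. Atomic sentences: $t_1=t_2$, $t_1\stackrel{\lambda}\Rightarrow t_2$ ($\lambda\in L$), forming $\mathrm{Sen}_b(\Sigma)$. Models: many-sorted algebras (possibly empty carriers) with label relations, monotone for $M$; usual satisfaction. Dynamic entailment $\vdash$: the least family $\vdash_\Sigma\subseteq\mathcal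 P(\mathrm{Sen}(\Sigma))^2$ closed under Monotonicity, Transitivity, Union, Translation along signature morphisms, and the rules: (R) $\Gamma\vdash t=t$; (S),(T) symmetry/transitivity of $=$; (F) congruence for function symbols; (P) $\Gamma\vdash t_1=t_1'$, $\Gamma\vdash t_2=t_2'$, $\Gamma\vdash t_1\stackrel{\lambda}\Rightarrow t_2$ give $\Gamma\vdash t_1'\stackrel{\lambda}\Rightarrow t_2'$; (M) for $f\in M$, $\Gamma\vdash t_j\stackrel{\lambda}\Rightarrow u_j$ gives $\Gamma\vdash f(\dots,t_j,\dots)\stackrel{\lambda}\Rightarrow f(\dots,u_j,\dots)$; (Comp$_I$) from $t_1\stackrel{\mathfrak a_1}\Rightarrow t$ and $t\stackrel{\mathfrak a_2}\Rightarrow t_2$ infer $t_1\stackrel{\mathfrak a_1;\mathfrak a_2}\Rightarrow t_2$; (Comp$_E$) if $\Gamma\vdash_\Sigma t_1\stackrel{\mathfrak a_1;\mathfrak a_2}\Rightarrow t_2$ and $\Gamma\cup\{t_1\stackrel{\mathfrak a_1}\Rightarrow x,x\stackrel{\mathfrak a_2}\Rightarrow t_2\}\vdash_{\Sigma[x]}\phi$ ($x$ new constant) then $\Gamma\vdash_\Sigma\phi$; (Union$_I$) from $t_1\stackrel{\mathfrak a_i}\Rightarrow t_2$ infer $t_1\stackrel{\mathfrak a_1\cup\mathfrak a_2}\Rightarrow t_2$; (Union$_E$) if $\Gamma\vdash t_1\stackrel{\mathfrak a_1\cup\mathfrak a_2}\Rightarrow t_2$ and $\Gamma\cup\{t_1\stackrel{\mathfrak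 a_i}\Rightarrow t_2\}\vdash\phi$ for $i=1,2$ then $\Gamma\vdash\phi$; (Star$_I$) from $t_1\stackrel{\mathfrak a^n}\Rightarrow t_2$ infer $t_1\stackrel{\mathfrak a^*}\Rightarrow t_2$; (Star$_E$) if $\Gamma\vdash t_1\stackrel{\mathfrak a^*}\Rightarrow t_2$ and $\Gamma\cup\{t_1\stackrel{\mathfrak a^n}\Rightarrow t_2\}\vdash\phi$ for all $n\in\omega$ then $\Gamma\vdash\phi$; (Neg$_D$) $\neg\neg\phi\vdash$-to-$\phi$; (False) from $\bot$ anything; (Neg$_I$) $\Gamma\cup\{\phi\}\vdash\bot$ gives $\Gamma\vdash\neg\phi$; (Neg$_E$) $\Gamma\vdash\neg\phi$ gives $\Gamma\cup\{\phi\}\vdash\bot$; (Disj$_I$) $\Gamma\vdash\phi$, $\phi\in\Phi$ give $\Gamma\vdash\bigvee\Phi$; (Disj$_E$) $\Gamma\vdash\bigvee\Phi$ and $\Gamma\cup\{\phi\}\vdash\gamma$ for all $\phi\in\Phi$ give $\Gamma\vdash\gamma$; (Quant$_I$) $\Gamma\cup\{\phi\}\vdash_{\Sigma[X]}\gamma$ gives $\Gamma\cup\{\exists X\phi\}\vdash_\Sigma\gamma$; (Quant$_E$) the converse; (Subst) $\Gamma\vdash_\Sigma\theta(\phi)$ gives $\Gamma\vdash_\Sigma\exists X\phi$. Syntactic forcing property over $\Sigma$: fix an $S$-sorted set $C$ of new constants with $C_s$ countably infinite for each $s$. $P$ is the set of pairs $p=(\Delta_p,\Gamma_p)$ where $\Delta_p$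 is $\Sigma$ extended with a finite set $C_p\subseteq C$ of constants and $\Gamma_p\subseteq\mathrm{Sen}(\Delta_p)$ with $\Gamma_p\not\vdash_{\Delta_p}\bot$; $p\le q$ iff $\Delta_p\subseteq\Delta_q$ and $\Gamma_p\subseteq\Gamma_q$; $\Delta(p)=\Delta_p$; $f(p)=\Gamma_p\cap\mathrm{Sen}_b(\Delta_p)$. Forcing relation on this $\mathbb P$: $p\Vdash\varphi$ iff $\varphi\in f(p)$ (atomic); $p\Vdash t_1\stackrel{\mathfrak a_1;\mathfrak a_2}\Rightarrow t_2$ iff $p\Vdash t_1\stackrel{\mathfrak a_1}\Rightarrow t$ and $p\Vdash t\stackrel{\mathfrak a_2}\Rightarrow t_2$ for some $t\in T_{\Delta_p}$; $p\Vdash t_1\stackrel{\mathfrak a_1\cup\mathfrak a_2}\Rightarrow t_2$ iff $p$ forces one of $t_1\stackrel{\mathfrak a_i}\Rightarrow t_2$; $p\Vdash t_1\stackrel{\mathfrak a^*}\Rightarrow t_2$ iff $p\Vdash t_1\stackrel{\mathfrak a^n}\Rightarrow t_2$ for some $n$; $p\Vdash\neg\phi$ iff no $q\ge p$ forces $\phi$; $p\Vdash\bigvee\Phi$ iff $p$ forces some $\phi\in\Phi$; $p\Vdash\exists X\phi$ iff $p\Vdash\theta(\phi)$ for some $\theta\colon X\to T_{\Delta_p}$. Weak forcing: $p\Vdash^w\phi$ iff $p\Vdash\neg\neg\phi$. *)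

(* Defs.v *)
From mathcomp Require Import all_boot.
From mathcomp Require Import boolp classical_sets functions cardinality.
From Stdlib Require List.

Set Implicit Arguments.
Unset Strict Implicit.
Unset Printing Implicit Defensive.

Local Open Scope classical_set_scope.

(* A word of sorts of length n is a map 'I_n -> sorts, so that signature
   morphisms act on arities by composition; constants are the symbols with
   n = 0. *)
Record signature := Signature {
  sorts : Type;
  funs : forall n, ('I_n -> sorts) -> sorts -> Type;
  monotonic : forall n (w : 'I_n -> sorts) (s : sorts), set (funs w s);
  labels : Type }.

Definition symbol (Sg : signature) :=
  {n : nat & {w : 'I_n -> sorts Sg & {s : sorts Sg & funs w s}}}.

Definition countable_signature (Sg : signature) : Prop :=
  [/\ countable [set: sorts Sg], countable [set: symbol Sg]
    & countable [set: labels Sg]].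

Definition arity0 (A : Type) (n : nat) : Type := if n is 0 then A else void.

Definition arity0_map (A B : Type) (g : A -> B) (n : nat) :
    arity0 A n -> arity0 B n :=
  if n is 0 then g else id.

Definition arity0_elim (A : Type) (n : nat) : arity0 A n -> A :=
  match n return arity0 A n -> A with
  | 0 => id
  | _.+1 => fun v => match v with end
  end.

Definition noarg (T : 'I_0 -> Type) (i : 'I_0) : T i :=
  match notF (ltn_ord i) with end.

(* Sg extended with a sorted family C of new, non-monotonic constants *)
Definition ext (Sg : signature) (C : sorts Sg -> Type) : signature :=
  {| sorts := sorts Sg;
     funs := fun n w s => (funs w s + arity0 (C s) n)%type;
     monotonic := fun n w s f => if f is inl g then monotonic g else False;
     labels := labels Sg |}.

(* A finite sorted set of n variables is given by the sorts of its members. *)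
Definition vars (S : Type) (n : nat) (X : 'I_n -> S) (s : S) : Type :=
  {i : 'I_n | X i = s}.

Notation extv Sg X := (@ext Sg (vars X)).

Inductive term (Sg : signature) : sorts Sg -> Type :=
| App n (w : 'I_n -> sorts Sg) (s : sorts Sg) (f : funs w s)
      (ts : forall i, term (w i)) : term s.

Definition cst (Sg : signature) (C : sorts Sg -> Type) (s : sorts Sg)
    (c : C s) : term (Sg := ext C) s :=
  @App (ext C) 0 (fun=> s) s (inr c) (@noarg _).

Inductive action (L : Type) : Type :=
| Lbl of L
| Comp of action L & action L
| Cup of action L & action L
| Star of action L.

(* the (n+1)-fold composition of a *)
Fixpoint act_powS (L : Type) (a : action L) (n : nat) : action L :=
  if n is m.+1 then Comp a (act_powS a m) else a.

(* The seq in Disj stands for the finite set of its elements. *)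
Inductive sen (Sg : signature) : Type :=
| Eq (s : sorts Sg) (t1 t2 : term s)
| Tr (s : sorts Sg) (a : action (labels Sg)) (t1 t2 : term s)
| Neg (phi : sen Sg)
| Disj (Phi : seq (sen Sg))
| Ex n (X : 'I_n -> sorts Sg) (phi : sen (extv Sg X)).

Arguments Disj {Sg} Phi.
Arguments Ex {Sg n} X phi.

Definition bot (Sg : signature) : sen Sg := Disj [::].
Arguments bot {Sg}.

(* t1 =[a^n]=> t2 *)
Definition Tr_pow (Sg : signature) (s : sorts Sg) (a : action (labels Sg))
    (n : nat) (t1 t2 : term s) : sen Sg :=
  if n is m.+1 then Tr (act_powS a m) t1 t2 else Eq t1 t2.

Definition basic (Sg : signature) : set (sen Sg) := fun phi =>
  match phi with
  | Eq _ _ _ => True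
  | Tr _ (Lbl _) _ _ => True
  | _ => False
  end.

Record morphism (Sg Sg' : signature) := Morphism {
  msort : sorts Sg -> sorts Sg';
  mfun : forall n (w : 'I_n -> sorts Sg) (s : sorts Sg),
    funs w s -> funs (fun i => msort (w i)) (msort s);
  mlabel : labels Sg -> labels Sg';
  mmono : forall n (w : 'I_n -> sorts Sg) (s : sorts Sg) (f : funs w s),
    monotonic f -> monotonic (mfun f) }.

(* Common generalization of signature morphisms and of substitutions of terms
   for constants: a symbol is sent either to a symbol or, when it is a
   constant, to a term.  Going under a quantifier requires this generality. *)
Record subst (Sg Sg' : signature) := Subst {
  ssort : sorts Sg -> sorts Sg';
  sfun : forall n (w : 'I_n -> sorts Sg) (s : sorts Sg), funs w s ->
    (funs (fun i => ssort (w i)) (ssort s) + arity0 (term (ssort s)) n)%type;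
  slabel : labels Sg -> labels Sg' }.

Definition subst_of_mor (Sg Sg' : signature) (chi : morphism Sg Sg') :
    subst Sg Sg' :=
  {| ssort := msort chi;
     sfun := fun n w s f => inl (mfun chi f);
     slabel := mlabel chi |}.

Fixpoint term_subst (Sg Sg' : signature) (th : subst Sg Sg') (s : sorts Sg)
    (t : term s) : term (ssort th s) :=
  match t in term s return term (ssort th s) with
  | App n w s f ts =>
      match sfun th f with
      | inl g => App g (fun i => term_subst th (ts i))
      | inr u => arity0_elim u
      end
  end.

Fixpoint act_map (L L' : Type) (g : L -> L') (a : action L) : action L' :=
  match a with
  | Lbl l => Lbl (g l)
  | Comp a1 a2 => Comp (act_map g a1) (act_map g a2)
  | Cup a1 a2 => Cup (act_map g a1) (act_map g a2)
  | Star a1 => Star (act_map g a1)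
  end.

Definition ext_incl (Sg : signature) (C : sorts Sg -> Type) :
    morphism Sg (ext C) :=
  {| msort := id : sorts Sg -> sorts (ext C);
     mfun := fun n w s f => inl f;
     mlabel := id : labels Sg -> labels (ext C);
     mmono := fun n w s f hf => hf |}.

Definition ext_map_fun (Sg : signature) (C D : sorts Sg -> Type)
    (g : forall s, C s -> D s) n (w : 'I_n -> sorts Sg) (s : sorts Sg)
    (f : @funs (ext C) _ w s) : @funs (ext D) _ w s :=
  match f with
  | inl f => inl f
  | inr c => inr (arity0_map (@g s) c)
  end.

Lemma ext_map_mono (Sg : signature) (C D : sorts Sg -> Type)
    (g : forall s, C s -> D s) n (w : 'I_n -> sorts Sg) (s : sorts Sg)
    (f : @funs (ext C) _ w s) :
  monotonic f -> monotonic (ext_map_fun g f).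
Proof. by case: f. Qed.

Definition ext_map (Sg : signature) (C D : sorts Sg -> Type)
    (g : forall s, C s -> D s) : morphism (ext C) (ext D) :=
  {| msort := id : sorts (ext C) -> sorts (ext D);
     mfun := ext_map_fun g;
     mlabel := id : labels (ext C) -> labels (ext D);
     mmono := ext_map_mono g |}.

Definition vars_map (S S' : Type) (g : S -> S') n (X : 'I_n -> S) (s : S)
    (x : vars X s) : vars (fun i => g (X i)) (g s) :=
  let: exist i e := x in exist _ i (congr1 g e).

Definition lift (Sg Sg' : signature) (th : subst Sg Sg') n
    (X : 'I_n -> sorts Sg) :
    subst (extv Sg X) (extv Sg' (fun i => ssort th (X i))) :=
  {| ssort := ssort th : sorts (extv Sg X) -> sorts (extv Sg' _);
     sfun := fun m w s (f : @funs (extv Sg X) _ w s) =>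
       match f with
       | inl f =>
           match sfun th f with
           | inl g => inl (inl g)
           | inr u =>
               inr (arity0_map
                      (fun t => term_subst (subst_of_mor (ext_incl _)) t) u)
           end
       | inr x => inl (inr (arity0_map (@vars_map _ _ (ssort th) _ X s) x))
       end;
     slabel := slabel th : labels (extv Sg X) -> labels (extv Sg' _) |}.

Fixpoint sen_subst (Sg Sg' : signature) (th : subst Sg Sg') (phi : sen Sg) :
    sen Sg' :=
  match phi with
  | Eq _ t1 t2 => Eq (term_subst th t1) (term_subst th t2)
  | Tr _ a t1 t2 =>
      Tr (act_map (slabel th) a) (term_subst th t1) (term_subst th t2)
  | Neg phi => Neg (sen_subst th phi)
  | Disj Phi => Disj (map (sen_subst th) Phi)
  | Ex _ X phi => Ex (fun i => ssort th (X i)) (sen_subst (lift th X) phi)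
  end.

Definition term_tr (Sg Sg' : signature) (chi : morphism Sg Sg') (s : sorts Sg)
    (t : term s) : term (msort chi s) := term_subst (subst_of_mor chi) t.

Definition sen_tr (Sg Sg' : signature) (chi : morphism Sg Sg') :
    sen Sg -> sen Sg' := sen_subst (subst_of_mor chi).

(* the substitution Sg[C] -> Sg determined by th : C -> T_Sg *)
Definition inst (Sg : signature) (C : sorts Sg -> Type)
    (th : forall s, C s -> term s) : subst (ext C) Sg :=
  {| ssort := id : sorts (ext C) -> sorts Sg;
     sfun := fun n w s (f : @funs (ext C) _ w s) =>
       match f with
       | inl f => inl f
       | inr c => inr (arity0_map (@th s) c)
       end;
     slabel := id : labels (ext C) -> labels Sg |}.

Notation upv X := (sen_tr (ext_incl (vars X))).
Notation uptv X := (term_tr (ext_incl (vars X))).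

Definition var1 (Sg : signature) (s : sorts Sg) : 'I_1 -> sorts Sg := fun=> s.
Definition x1 (Sg : signature) (s : sorts Sg) :
    term (Sg := extv Sg (var1 s)) s :=
  cst (C := vars (var1 s)) (exist _ ord0 (erefl s)).

Reserved Notation "G |-- P" (at level 70, no associativity).
Reserved Notation "G |-1 p" (at level 70, no associativity).

Inductive entails :
    forall Sg : signature, set (sen Sg) -> set (sen Sg) -> Prop :=
| Monotonicity Sg (G P : set (sen Sg)) : P `<=` G -> G |-- P
| Transitivity Sg (G P Q : set (sen Sg)) : G |-- P -> P |-- Q -> G |-- Q
| Unions Sg (G P : set (sen Sg)) : (forall phi, P phi -> G |-1 phi) -> G |-- P
| Translation Sg Sg' (chi : morphism Sg Sg') (G P : set (sen Sg)) :
    G |-- P -> sen_tr chi @` G |-- sen_tr chi @` P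
| Rule_R Sg (G : set (sen Sg)) s (t : term s) : G |-1 Eq t t
| Rule_S Sg (G : set (sen Sg)) s (t1 t2 : term s) :
    G |-1 Eq t1 t2 -> G |-1 Eq t2 t1
| Rule_T Sg (G : set (sen Sg)) s (t1 t2 t3 : term s) :
    G |-1 Eq t1 t2 -> G |-1 Eq t2 t3 -> G |-1 Eq t1 t3
| Rule_F Sg (G : set (sen Sg)) n (w : 'I_n -> sorts Sg) s (f : funs w s)
    (ts us : forall i, term (w i)) :
    (forall i, G |-1 Eq (ts i) (us i)) -> G |-1 Eq (App f ts) (App f us)
| Rule_P Sg (G : set (sen Sg)) s (l : labels Sg) (t1 t2 u1 u2 : term s) :
    G |-1 Eq t1 u1 -> G |-1 Eq t2 u2 -> G |-1 Tr (Lbl l) t1 t2 ->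
    G |-1 Tr (Lbl l) u1 u2
| Rule_M Sg (G : set (sen Sg)) n (w : 'I_n -> sorts Sg) s (f : funs w s)
    (l : labels Sg) (ts us : forall i, term (w i)) (j : 'I_n) :
    monotonic f -> (forall i, i <> j -> us i = ts i) ->
    G |-1 Tr (Lbl l) (ts j) (us j) ->
    G |-1 Tr (Lbl l) (App f ts) (App f us)
| Comp_I Sg (G : set (sen Sg)) s a1 a2 (t1 t t2 : term s) :
    G |-1 Tr a1 t1 t -> G |-1 Tr a2 t t2 -> G |-1 Tr (Comp a1 a2) t1 t2
| Comp_E Sg (G : set (sen Sg)) s a1 a2 (t1 t2 : term s) (phi : sen Sg) :
    G |-1 Tr (Comp a1 a2) t1 t2 ->
    upv (var1 s) @` G `|`
      [set Tr (Sg := extv Sg (var1 s)) a1 (uptv (var1 s) t1) (x1 s);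
           Tr (Sg := extv Sg (var1 s)) a2 (x1 s) (uptv (var1 s) t2)]
      |-1 upv (var1 s) phi ->
    G |-1 phi
| Union_I1 Sg (G : set (sen Sg)) s a1 a2 (t1 t2 : term s) :
    G |-1 Tr a1 t1 t2 -> G |-1 Tr (Cup a1 a2) t1 t2
| Union_I2 Sg (G : set (sen Sg)) s a1 a2 (t1 t2 : term s) :
    G |-1 Tr a2 t1 t2 -> G |-1 Tr (Cup a1 a2) t1 t2
| Union_E Sg (G : set (sen Sg)) s a1 a2 (t1 t2 : term s) (phi : sen Sg) :
    G |-1 Tr (Cup a1 a2) t1 t2 ->
    G `|` [set Tr a1 t1 t2] |-1 phi -> G `|` [set Tr a2 t1 t2] |-1 phi ->
    G |-1 phi
| Star_I Sg (G : set (sen Sg)) s a (t1 t2 : term s) n :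
    G |-1 Tr_pow a n t1 t2 -> G |-1 Tr (Star a) t1 t2
| Star_E Sg (G : set (sen Sg)) s a (t1 t2 : term s) (phi : sen Sg) :
    G |-1 Tr (Star a) t1 t2 ->
    (forall n, G `|` [set Tr_pow a n t1 t2] |-1 phi) ->
    G |-1 phi
| Neg_D Sg (G : set (sen Sg)) (phi : sen Sg) :
    G |-1 Neg (Neg phi) -> G |-1 phi
| False_E Sg (G : set (sen Sg)) (phi : sen Sg) : G |-1 bot -> G |-1 phi
| Neg_I Sg (G : set (sen Sg)) (phi : sen Sg) :
    G `|` [set phi] |-1 bot -> G |-1 Neg phi
| Neg_E Sg (G : set (sen Sg)) (phi : sen Sg) :
    G |-1 Neg phi -> G `|` [set phi] |-1 bot
| Disj_I Sg (G : set (sen Sg)) (Phi : seq (sen Sg)) (phi : sen Sg) :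
    G |-1 phi -> List.In phi Phi -> G |-1 Disj Phi
| Disj_E Sg (G : set (sen Sg)) (Phi : seq (sen Sg)) (gam : sen Sg) :
    G |-1 Disj Phi ->
    (forall phi, List.In phi Phi -> G `|` [set phi] |-1 gam) ->
    G |-1 gam
| Quant_I Sg (G : set (sen Sg)) n (X : 'I_n -> sorts Sg)
    (phi : sen (extv Sg X)) (gam : sen Sg) :
    upv X @` G `|` [set phi] |-1 upv X gam -> G `|` [set Ex X phi] |-1 gam
| Quant_E Sg (G : set (sen Sg)) n (X : 'I_n -> sorts Sg)
    (phi : sen (extv Sg X)) (gam : sen Sg) :
    G `|` [set Ex X phi] |-1 gam -> upv X @` G `|` [set phi] |-1 upv X gam
| Rule_Subst Sg (G : set (sen Sg)) n (X : 'I_n -> sorts Sg)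
    (phi : sen (extv Sg X)) (th : forall s, vars X s -> term s) :
    G |-1 sen_subst (inst th) phi -> G |-1 Ex X phi
where "G |-- P" := (entails G P)
  and "G |-1 p" := (entails G (set1 p)).

Section Forcing.
Variables (Sg : signature) (C : sorts Sg -> Type).

Definition Delta_consts (D : set {s : sorts Sg & C s}) (s : sorts Sg) : Type :=
  [set c : C s | D (existT C s c)].

Definition Delta (D : set {s : sorts Sg & C s}) : signature :=
  ext (Delta_consts D).

Definition Delta_incl_fun (D E : set {s : sorts Sg & C s}) (h : D `<=` E)
    (s : sorts Sg) (c : Delta_consts D s) : Delta_consts E s :=
  exist _ (val c) (mem_set (h _ (set_mem (valP c)))).

Definition Delta_incl (D E : set {s : sorts Sg & C s}) (h : D `<=` E) :
    morphism (Delta D) (Delta E) := ext_map (Delta_incl_fun h).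

Record condition := Condition {
  consts : set {s : sorts Sg & C s};
  consts_finite : finite_set consts;
  axs : set (sen (Delta consts));
  axs_consistent : ~ entails axs [set bot] }.

Arguments axs c _ : clear implicits.

Record cond_le (p q : condition) : Prop := CondLe {
  le_consts : consts p `<=` consts q;
  le_axs : sen_tr (Delta_incl le_consts) @` axs p `<=` axs q }.

Definition Delta_of (p : condition) : signature := Delta (consts p).

Definition atoms (p : condition) : set (sen (Delta_of p)) :=
  axs p `&` @basic (Delta_of p).

Arguments atoms p _ : clear implicits.

(* The star clause is the result of unfolding the clauses for equations and
   for composition in "p forces t1 =[a^n]=> t2 for some n". *)
Fixpoint forces_tr (p : condition) (s : sorts (Delta_of p))
    (a : action (labels (Delta_of p))) (t1 t2 : term s) : Prop :=
  match a with
  | Lbl l => atoms p (Tr (Lbl l) t1 t2)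
  | Comp a1 a2 => exists t, forces_tr a1 t1 t /\ forces_tr a2 t t2
  | Cup a1 a2 => forces_tr a1 t1 t2 \/ forces_tr a2 t1 t2
  | Star a1 =>
      let fix powS (n : nat) (u1 u2 : term s) : Prop :=
        if n is m.+1 then exists t, forces_tr a1 u1 t /\ powS m t u2
        else forces_tr a1 u1 u2 in
      exists n, if n is m.+1 then powS m t1 t2 else atoms p (Eq t1 t2)
  end.

End Forcing.

Arguments axs {Sg C} c _.
Arguments atoms {Sg C} p _.

Fixpoint depth (Sg : signature) (phi : sen Sg) : nat :=
  match phi with
  | Eq _ _ _ | Tr _ _ _ _ => 0
  | Neg phi => (depth phi).+1
  | Disj Phi => (foldr (fun psi m => maxn (depth psi) m) 0 Phi).+1
  | Ex _ _ phi => (depth phi).+1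
  end.

(* Forcing is defined by recursion on the depth of sentences, which is
   invariant under substitution; the lemmas forces_Eq, ..., forces_Ex below
   are its defining clauses. *)
Fixpoint forces_at (Sg : signature) (C : sorts Sg -> Type) (k : nat)
    (p : condition C) (phi : sen (Delta_of p)) {struct k} : Prop :=
  match phi, k with
  | Eq _ t1 t2, _ => atoms p (Eq t1 t2)
  | Tr _ a t1 t2, _ => forces_tr a t1 t2
  | Neg psi, k.+1 =>
      forall (q : condition C) (h : cond_le p q),
        ~ forces_at k (p := q) (sen_tr (Delta_incl (le_consts h)) psi)
  | Disj Phi, k.+1 => exists psi, List.In psi Phi /\ forces_at k psi
  | Ex _ X psi, k.+1 =>
      exists th : (forall s, vars X s -> term s),
        forces_at k (p := p) (sen_subst (inst th) psi)
  | _, 0 => False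
  end.

Definition forces (Sg : signature) (C : sorts Sg -> Type) (p : condition C)
    (phi : sen (Delta_of p)) : Prop := forces_at (depth phi) phi.

Definition weak_forces (Sg : signature) (C : sorts Sg -> Type)
    (p : condition C) (phi : sen (Delta_of p)) : Prop :=
  forces (Neg (Neg phi)).

Arguments forces {Sg C} p phi.
Arguments weak_forces {Sg C} p phi.

Lemma depth_subst (Sg Sg' : signature) (th : subst Sg Sg') (phi : sen Sg) :
  depth (sen_subst th phi) = depth phi.
Proof.
move: Sg Sg' th phi.
fix IH 4 => Sg Sg' th [s t1 t2|s a t1 t2|psi|Phi|n X psi] //=.
- by rewrite IH.
- congr _.+1; elim: Phi => [//|psi Phi IHPhi] /=.
  by rewrite IH IHPhi.
- by rewrite IH.
Qed.

Lemma depth_Disj (Sg : signature) (Phi : seq (sen Sg)) (phi : sen Sg) :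
  List.In phi Phi -> depth phi < depth (Disj Phi).
Proof.
rewrite /= ltnS; elim: Phi => [//|chi Phi IH] /= [<-|/IH le].
  exact: leq_maxl.
exact: leq_trans le (leq_maxr _ _).
Qed.

Lemma forces_at_stable (Sg : signature) (C : sorts Sg -> Type) (k m : nat)
    (p : condition C) (phi : sen (Delta_of p)) :
  depth phi <= k -> depth phi <= m -> forces_at k phi <-> forces_at m phi.
Proof.
elim: k m p phi => [|k IH] [|m] p phi;
  case: phi => [s t1 t2|s a t1 t2|psi|Phi|n X psi] //= hk hm.
- split=> H q h.
    by rewrite -(IH m) ?depth_subst //; exact: H.
  by rewrite (IH m) ?depth_subst //; exact: H.
- by split=> -[psi [hin H]]; exists psi; split => //; move: H;
    rewrite (IH m) // -ltnS (leq_trans (depth_Disj hin)).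
- by split=> -[th H]; exists th; move: H; rewrite (IH m) ?depth_subst.
Qed.

Lemma forces_at_ge (Sg : signature) (C : sorts Sg -> Type) (k : nat)
    (p : condition C) (phi : sen (Delta_of p)) :
  depth phi <= k -> forces_at k phi <-> forces p phi.
Proof. by move=> hk; apply: forces_at_stable. Qed.

Section ForcesClauses.
Variables (Sg : signature) (C : sorts Sg -> Type) (p : condition C).

Lemma forces_Eq s (t1 t2 : term (Sg := Delta_of p) s) :
  forces p (Eq t1 t2) <-> atoms p (Eq t1 t2).
Proof. by []. Qed.

Lemma forces_Lbl s l (t1 t2 : term (Sg := Delta_of p) s) :
  forces p (Tr (Lbl l) t1 t2) <-> atoms p (Tr (Lbl l) t1 t2).
Proof. by []. Qed.

Lemma forces_Comp s a1 a2 (t1 t2 : term (Sg := Delta_of p) s) :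
  forces p (Tr (Comp a1 a2) t1 t2) <->
  exists t, forces p (Tr a1 t1 t) /\ forces p (Tr a2 t t2).
Proof. by []. Qed.

Lemma forces_Cup s a1 a2 (t1 t2 : term (Sg := Delta_of p) s) :
  forces p (Tr (Cup a1 a2) t1 t2) <->
  forces p (Tr a1 t1 t2) \/ forces p (Tr a2 t1 t2).
Proof. by []. Qed.

Lemma forces_Star s a (t1 t2 : term (Sg := Delta_of p) s) :
  forces p (Tr (Star a) t1 t2) <-> exists n, forces p (Tr_pow a n t1 t2).
Proof.
rewrite /forces /=; set pw := (fix powS (n : nat) (u1 u2 : term s) := _).
have pwE n u1 u2 : pw n u1 u2 <-> forces_tr (act_powS a n) u1 u2.
  elim: n u1 u2 => [//|n IH] u1 u2 /=.
  by split=> -[t [? ?]]; exists t; split => //; apply/IH.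
by split=> -[[|n] H]; [exists 0|exists n.+1|exists 0|exists n.+1] => //=;
  apply/pwE.
Qed.

Lemma forces_Neg (phi : sen (Delta_of p)) :
  forces p (Neg phi) <->
  forall (q : condition C) (h : cond_le p q),
    ~ forces q (sen_tr (Delta_incl (le_consts h)) phi).
Proof.
rewrite {1}/forces /=; split=> H q h; move: (H q h).
  by rewrite forces_at_ge ?depth_subst.
by rewrite forces_at_ge ?depth_subst.
Qed.

Lemma forces_Disj (Phi : seq (sen (Delta_of p))) :
  forces p (Disj Phi) <-> exists phi, List.In phi Phi /\ forces p phi.
Proof.
rewrite {1}/forces /=.
by split=> -[psi [hin H]]; exists psi; split => //; move: H;
  rewrite forces_at_ge // -ltnS; exact: depth_Disj.
Qed.

Lemma forces_Ex n (X : 'I_n -> sorts (Delta_of p))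
    (phi : sen (extv (Delta_of p) X)) :
  forces p (Ex X phi) <->
  exists th : (forall s, vars X s -> term s),
    forces p (sen_subst (inst th) phi).
Proof.
rewrite {1}/forces /=.
by split=> -[th H]; exists th; move: H; rewrite forces_at_ge ?depth_subst.
Qed.

End ForcesClauses.

(* Main.v *)
(** The key is that forcing is sound for provability and complete up to passing
    to a stronger condition: if [p] forces [phi] then [axs p] proves [phi], and
    if [axs p] proves [phi] then some [q] above [p] forces [phi].  Both follow
    by one induction on [phi].  Each elimination rule, read contrapositively,
    says that a consistent theory proving a compound sentence has a consistent
    extension by a component of it; for compositions and existential
    quantifiers the witnesses are fresh constants taken from [C], which are
    available because a condition uses only finitely many.  Since a theory that
    does not prove [phi] is consistent with [Neg phi], soundness and
    completeness yield the equivalence for weak forcing. *)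

Require Import Defs.
From mathcomp Require Import all_boot.
From mathcomp Require Import boolp classical_sets functions cardinality.

Set Implicit Arguments.
Unset Strict Implicit.
Unset Printing Implicit Defensive.

Local Open Scope classical_set_scope.
Local Open Scope card_scope.

Local Notation lift := Defs.lift.

(** * Substitutions *)

Lemma subst_ext (Sg Sg' : signature) (g : sorts Sg -> sorts Sg')
    (f1 f2 : forall n (w : 'I_n -> sorts Sg) (s : sorts Sg), funs w s ->
      (funs (fun i => g (w i)) (g s) + arity0 (term (g s)) n)%type)
    (l : labels Sg -> labels Sg') :
  (forall n (w : 'I_n -> sorts Sg) s (f : funs w s), f1 n w s f = f2 n w s f) ->
  Subst f1 l = Subst f2 l.
Proof.
move=> H; congr Subst.
by do 4! (apply: functional_extensionality_dep => ?); exact: H.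
Qed.

Definition comp_subst (S1 S2 S3 : signature) (th : subst S1 S2)
    (ta : subst S2 S3) : subst S1 S3 :=
  {| ssort := fun s => ssort ta (ssort th s);
     sfun := fun n w s f =>
       match sfun th f with
       | inl g => sfun ta g
       | inr u => inr (arity0_map (fun t => term_subst ta t) u)
       end;
     slabel := fun l => slabel ta (slabel th l) |}.

Lemma term_subst_comp (S1 S2 S3 : signature) (th : subst S1 S2)
    (ta : subst S2 S3) s (t : term (Sg := S1) s) :
  term_subst ta (term_subst th t) = term_subst (comp_subst th ta) t.
Proof.
elim: t => n w s' f ts IH /=.
(* The term [u] can occur only in arity zero: for positive [n] its type is [void], and for [n = 0]
   both sides compute to the same term. *)
case: (sfun th f) => [g|u] /=; last by case: n w f ts IH u.
case: (sfun ta g) => // h.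
congr (App h _); apply: functional_extensionality_dep => i; exact: IH.
Qed.

Lemma act_map_comp (L1 L2 L3 : Type) (g : L1 -> L2) (h : L2 -> L3)
    (a : action L1) :
  act_map h (act_map g a) = act_map (fun l => h (g l)) a.
Proof. by elim: a => //= [a -> b ->|a -> b ->|a ->]. Qed.

Lemma act_map_id (L : Type) (a : action L) : act_map id a = a.
Proof. by elim: a => //= [a -> b ->|a -> b ->|a ->]. Qed.

(** Weakening is natural: an old term contains no bound variable, so [lift th X] acts on it as [th]
    does. *)
Lemma term_lift_incl (S1 S2 : signature) (th : subst S1 S2) n
    (X : 'I_n -> sorts S1) s (t : term (Sg := S1) s) :
  term_subst (lift th X) (term_subst (subst_of_mor (ext_incl (vars X))) t) =
  term_subst (subst_of_mor (ext_incl (vars (fun i => ssort th (X i)))))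
    (term_subst th t).
Proof.
elim: t => m w s' f ts IH /=.
case: (sfun th f) => [g|u] /=; last by case: m w f ts IH u.
congr (App _ _); apply: functional_extensionality_dep => i; exact: IH.
Qed.

Lemma lift_comp (S1 S2 S3 : signature) (th : subst S1 S2)
    (ta : subst S2 S3) n (X : 'I_n -> sorts S1) :
  comp_subst (lift th X) (lift ta (fun i => ssort th (X i))) =
  lift (comp_subst th ta) X.
Proof.
apply: subst_ext => m w s [f|x] /=.
  case: (sfun th f) => [g //|u]; congr inr.
  case: m w f u => [|m] //= w f u.
  exact: (term_lift_incl ta (fun i => ssort th (X i)) u).
congr inl; congr inr; case: m w x => [|m] //= w [i e].
by congr exist; exact: Prop_irrelevance.
Qed.

Lemma sen_subst_comp (S1 S2 S3 : signature) (th : subst S1 S2)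
    (ta : subst S2 S3) (phi : sen S1) :
  sen_subst ta (sen_subst th phi) = sen_subst (comp_subst th ta) phi.
Proof.
move: S1 S2 S3 th ta phi.
(* An explicit fixpoint, because recursive calls are needed on the members of the list under [Disj],
   and [Ex] changes the signatures. *)
fix IH 6 => S1 S2 S3 th ta [s t1 t2|s a t1 t2|psi|Phi|n X psi] /=.
- by rewrite !term_subst_comp.
- by rewrite !term_subst_comp act_map_comp.
- by rewrite IH.
- by congr Disj; elim: Phi => [//|psi Phi IHPhi] /=; rewrite IH IHPhi.
- by rewrite IH lift_comp.
Qed.

Definition id_subst (Sg : signature) : subst Sg Sg :=
  {| ssort := id; sfun := fun n w s f => inl f; slabel := id |}.

Lemma lift_id (Sg : signature) n (X : 'I_n -> sorts Sg) :
  lift (id_subst Sg) X = id_subst (extv Sg X).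
Proof.
apply: subst_ext => m w s [f //|x] /=.
congr inl; congr inr; case: m w x => [|m] //= w [i e].
by congr exist; exact: Prop_irrelevance.
Qed.

Lemma term_subst_id (Sg : signature) s (t : term (Sg := Sg) s) :
  term_subst (id_subst Sg) t = t.
Proof.
elim: t => n w s' f ts IH /=.
congr (App f _); apply: functional_extensionality_dep => i; exact: IH.
Qed.

Lemma sen_subst_id (Sg : signature) (phi : sen Sg) :
  sen_subst (id_subst Sg) phi = phi.
Proof.
move: Sg phi.
fix IH 2 => Sg [s t1 t2|s a t1 t2|psi|Phi|n X psi] /=.
- by rewrite !term_subst_id.
- by rewrite !term_subst_id act_map_id.
- by rewrite IH.
- by congr Disj; elim: Phi => [//|psi Phi IHPhi] /=; rewrite IH IHPhi.
- by rewrite lift_id IH.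
Qed.

Lemma term_inst_incl (Sg : signature) (C : sorts Sg -> Type)
    (th : forall s, C s -> term s) s (t : term (Sg := Sg) s) :
  term_subst (inst th) (term_subst (subst_of_mor (ext_incl C)) t) = t.
Proof.
elim: t => n w s' f ts IH /=.
congr (App f _); apply: functional_extensionality_dep => i; exact: IH.
Qed.

(* A substitution may send a constant to a symbol or to the term formed by that
   symbol; normalization always chooses the term. *)
Definition norm_cst (Sg : signature) n (w : 'I_n -> sorts Sg) (s : sorts Sg) :
    funs w s + arity0 (term s) n -> funs w s + arity0 (term s) n :=
  match n return forall w : 'I_n -> sorts Sg,
    funs w s + arity0 (term s) n -> funs w s + arity0 (term s) n
  with
  | 0 => fun w u => if u is inl g then inr (App g (@noarg _)) else u
  | _.+1 => fun w u => u
  end w.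

Definition norm_subst (S1 S2 : signature) (th : subst S1 S2) : subst S1 S2 :=
  {| ssort := ssort th;
     sfun := fun n w s f => norm_cst (sfun th f);
     slabel := slabel th |}.

Lemma noargE (T : 'I_0 -> Type) (ts : forall i, T i) : ts = @noarg T.
Proof. by apply: functional_extensionality_dep => -[]. Qed.

(** Words over ['I_0] agree only by extensionality, so a constant applied at an arbitrary empty word
    must be transported to the word chosen in [cst]. *)
Lemma App_cst (Sg : signature) (C : sorts Sg -> Type) (w : 'I_0 -> sorts Sg)
    s (c : C s) :
  @App (ext C) 0 w s (inr c) (@noarg _) = Defs.cst c.
Proof.
have we : w = (fun=> s) by apply: functional_extensionality_dep => -[].
by case: _ / (esym we).
Qed.

Lemma term_subst_norm (S1 S2 : signature) (th : subst S1 S2) s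
    (t : term (Sg := S1) s) : term_subst (norm_subst th) t = term_subst th t.
Proof.
elim: t => n w s' f ts IH /=.
have {IH}tsE : (fun i => term_subst (norm_subst th) (ts i)) =
    (fun i => term_subst th (ts i)).
  by apply: functional_extensionality_dep => i; exact: IH.
case: n w f ts tsE => [|n] w f ts tsE /=; case: (sfun th f) => //= g.
  by rewrite -(noargE (fun i => term_subst th (ts i))).
by rewrite tsE.
Qed.

(** The outer normalization absorbs the inner one: weakening the term of a symbol gives the term of
    the weakened symbol. *)
Lemma norm_lift (S1 S2 : signature) (th : subst S1 S2) n
    (X : 'I_n -> sorts S1) :
  norm_subst (lift (norm_subst th) X) = norm_subst (lift th X).
Proof.
apply: subst_ext => -[|m] w s [f|x] //=; case: (sfun th f) => //= g.
by congr inr; congr App; exact: noargE.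
Qed.

(** Substitutions with the same effect may differ as records; this lets them be compared through
    their normal forms. *)
Lemma sen_subst_norm (S1 S2 : signature) (th : subst S1 S2) (phi : sen S1) :
  sen_subst (norm_subst th) phi = sen_subst th phi.
Proof.
move: S1 S2 th phi.
fix IH 4 => S1 S2 th [s t1 t2|s a t1 t2|psi|Phi|n X psi] /=.
- by rewrite !term_subst_norm.
- by rewrite !term_subst_norm.
- by rewrite IH.
- by congr Disj; elim: Phi => [//|psi Phi IHPhi] /=; rewrite IH IHPhi.
- by rewrite -[in LHS]IH norm_lift IH.
Qed.

(** * Entailment *)

Section Entailment.
Variable Sg : signature.
Implicit Types (G H : set (sen Sg)) (phi psi : sen Sg).

Lemma entails_ax G phi : G phi -> entails G [set phi].
Proof. by move=> h; apply: Monotonicity => _ ->. Qed.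

Lemma entails_weaken G H phi :
  G `<=` H -> entails G [set phi] -> entails H [set phi].
Proof. by move=> GH; apply: Transitivity; exact: Monotonicity. Qed.

Lemma entails_cut G phi psi :
  entails G [set phi] -> entails (G `|` [set phi]) [set psi] ->
  entails G [set psi].
Proof.
move=> h; apply: Transitivity; apply: Unions => chi [/entails_ax //|->//].
Qed.

Lemma entails_contra G phi :
  entails (G `|` [set Neg phi]) [set bot] -> entails G [set phi].
Proof. by move=> h; apply: Neg_D; exact: Neg_I. Qed.

Lemma entails_absurd G phi :
  entails G [set phi] -> entails G [set Neg phi] -> entails G [set bot].
Proof. by move=> h /Neg_E; exact: entails_cut. Qed.

End Entailment.

Lemma entails_tr (S1 S2 : signature) (chi : morphism S1 S2)
    (G : set (sen S1)) (H : set (sen S2)) (phi : sen S1) :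
  sen_tr chi @` G `<=` H -> entails G [set phi] ->
  entails H [set sen_tr chi phi].
Proof.
by move=> GH /(Translation chi); rewrite image_set1; exact: entails_weaken.
Qed.

(** * Nested extensions by constants *)

Section Merge.
Variables (Sg : signature) (A B E : sorts Sg -> Type).
Variables (a : forall s, A s -> E s) (b : forall s, B s -> E s).
Variable (d : forall s, E s -> A s + B s).
Hypothesis da : forall s x, d (@a s x) = inl x.
Hypothesis db : forall s x, d (@b s x) = inr x.

(** The elimination rules add variables on top of constants already added, whereas a condition lives
    over a single extension. The maps [a] and [b] embed both layers disjointly into [E], with [d] a
    left inverse of their copairing. *)
Definition merge_fun n (w : 'I_n -> sorts Sg) (s : sorts Sg)
    (f : @funs (@ext (ext A) B) _ w s) : @funs (ext E) _ w s :=
  match f with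
  | inl (inl f) => inl f
  | inl (inr x) => inr (arity0_map (@a s) x)
  | inr x => inr (arity0_map (@b s) x)
  end.

Lemma merge_mono n (w : 'I_n -> sorts Sg) (s : sorts Sg)
    (f : @funs (@ext (ext A) B) _ w s) :
  monotonic f -> monotonic (merge_fun f).
Proof. by case: f => [[]|]. Qed.

Definition merge : morphism (@ext (ext A) B) (ext E) :=
  {| msort := id : sorts (@ext (ext A) B) -> sorts (ext E);
     mfun := merge_fun;
     mlabel := id : labels (@ext (ext A) B) -> labels (ext E);
     mmono := merge_mono |}.

Definition unmerge_cst n (s : sorts Sg) :
    arity0 (E s) n -> (arity0 (A s) n + arity0 (B s) n)%type :=
  match n with
  | 0 => @d s
  | _.+1 => fun v => match v with end
  end.

Definition unmerge_fun n (w : 'I_n -> sorts Sg) (s : sorts Sg)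
    (f : @funs (ext E) _ w s) : @funs (@ext (ext A) B) _ w s :=
  match f with
  | inl f => inl (inl f)
  | inr x =>
      match unmerge_cst x with
      | inl y => inl (inr y)
      | inr y => inr y
      end
  end.

Lemma unmerge_mono n (w : 'I_n -> sorts Sg) (s : sorts Sg)
    (f : @funs (ext E) _ w s) :
  monotonic f -> monotonic (unmerge_fun f).
Proof. by case: f. Qed.

Definition unmerge : morphism (ext E) (@ext (ext A) B) :=
  {| msort := id : sorts (ext E) -> sorts (@ext (ext A) B);
     mfun := unmerge_fun;
     mlabel := id : labels (ext E) -> labels (@ext (ext A) B);
     mmono := unmerge_mono |}.

Lemma mergeK : cancel (sen_tr merge) (sen_tr unmerge).
Proof.
move=> phi; rewrite /sen_tr sen_subst_comp.
rewrite (_ : comp_subst _ _ = id_subst _) ?sen_subst_id //.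
apply: subst_ext => n w s [[f //|x]|x] /=; congr inl.
  by case: n w x => //= w x; rewrite da.
by case: n w x => //= w x; rewrite db.
Qed.

(** A contradiction over [ext E] pulls back along [unmerge], a left inverse of [merge] on
    sentences. *)
Lemma merge_consistent (G : set (sen (@ext (ext A) B))) :
  ~ entails G [set bot] -> ~ entails (sen_tr merge @` G) [set bot].
Proof.
move=> cG /(@entails_tr _ _ unmerge _ G) h; apply/cG/h.
by move=> _ [_ [phi Gphi <-] <-]; rewrite mergeK.
Qed.

End Merge.

(** * Conditions *)

Lemma fresh_constants (S : Type) (C : S -> Type) (D : set {s : S & C s})
    n (X : 'I_n -> S) :
  (forall s : S, [set: C s] #= [set: nat]) -> finite_set D ->
  exists c : forall i, C (X i),
    injective (fun i => existT C (X i) (c i)) /\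
    forall i, ~ D (existT C (X i) (c i)).
Proof.
move=> hC finD.
have inv s : exists fg : (C s -> nat) * (nat -> C s), cancel fg.2 fg.1.
  have /card_set_bijP [f [_ _ fS]] := hC s.
  have /choice [g gP] : forall k, exists x, f x = k.
    by move=> k; have [x _ <-] := fS k I; exists x.
  by exists (f, g).
(* One numbering for the constants of all sorts; [pick s k] has sort [s] and code [k]. *)
pose code (x : {s : S & C s}) := (sval (cid (inv (tag x)))).1 (tagged x).
pose pick s := (sval (cid (inv s))).2.
have pickK s k : code (existT C s (pick s k)) = k.
  exact: (svalP (cid (inv s))).
have [N ltN] : exists N, forall x, D x -> code x < N.
  have /finite_seqP [r rE] := finite_image code finD.
  exists (\max_(k <- r) k).+1 => x Dx; rewrite ltnS.
  have rx : (code @` D) (code x) by exists x.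
  by apply: leq_bigmax_seq => //; move: rx; rewrite rE.
(* Codes from [N] on lie outside [D], and the offset [i] separates the choices even across sorts. *)
exists (fun i => pick (X i) (N + i)); split.
  move=> i j /(congr1 code); rewrite !pickK => /addnI.
  exact: val_inj.
by move=> i /ltN; rewrite pickK ltnNge leq_addr.
Qed.

Section Conditions.
Variables (Sg : signature) (C : sorts Sg -> Type).
Implicit Types p q r : condition C.

Lemma Delta_incl_comp (D1 D2 D3 : set {s : sorts Sg & C s})
    (h12 : D1 `<=` D2) (h23 : D2 `<=` D3) (h13 : D1 `<=` D3) :
  comp_subst (subst_of_mor (Delta_incl h12)) (subst_of_mor (Delta_incl h23)) =
  subst_of_mor (Delta_incl h13).
Proof.
apply: subst_ext => n w s [f //|x] /=; congr inl; congr inr.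
by case: n w x => //= w x; apply: val_inj.
Qed.

Lemma Delta_incl_id (D : set {s : sorts Sg & C s}) (h : D `<=` D) :
  subst_of_mor (Delta_incl h) = id_subst (Delta D).
Proof.
apply: subst_ext => n w s [f //|x] /=; congr inl; congr inr.
by case: n w x => //= w x; apply: val_inj.
Qed.

Definition le_tr p q (h : cond_le p q) : sen (Delta_of p) -> sen (Delta_of q) :=
  sen_tr (Delta_incl (le_consts h)).

Lemma le_tr_comp p q r (hpq : cond_le p q) (hqr : cond_le q r)
    (hpr : cond_le p r) phi : le_tr hqr (le_tr hpq phi) = le_tr hpr phi.
Proof.
by rewrite /le_tr /sen_tr sen_subst_comp (Delta_incl_comp _ _ (le_consts hpr)).
Qed.

Lemma le_tr_id p (h : cond_le p p) phi : le_tr h phi = phi.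
Proof. by rewrite /le_tr /sen_tr Delta_incl_id sen_subst_id. Qed.

Lemma cond_le_refl p : cond_le p p.
Proof.
exists (fun _ => id) => _ [phi h <-].
by rewrite /sen_tr Delta_incl_id sen_subst_id.
Qed.

Lemma cond_le_trans p q r : cond_le p q -> cond_le q r -> cond_le p r.
Proof.
move=> [h1 h2] [h3 h4].
have h13 := subset_trans h1 h3; exists h13 => _ [phi h <-].
apply: h4; exists (sen_tr (Delta_incl h1) phi); first by apply: h2; exists phi.
by rewrite /sen_tr sen_subst_comp (Delta_incl_comp _ _ h13).
Qed.

Lemma le_axs_tr p q (h : cond_le p q) phi : axs p phi -> axs q (le_tr h phi).
Proof. by move=> pphi; exact: (@le_axs _ _ _ _ h _ (imageP _ pphi)). Qed.

Lemma entails_le p q (h : cond_le p q) phi :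
  entails (axs p) [set phi] -> entails (axs q) [set le_tr h phi].
Proof. exact/entails_tr/le_axs. Qed.

Lemma extend_axiom p (phi : sen (Delta_of p)) :
  ~ entails (axs p `|` [set phi]) [set bot] ->
  exists q (h : cond_le p q), axs q (le_tr h phi).
Proof.
move=> cons; pose q := Condition (consts_finite p) cons.
have h : cond_le p q.
  have pq : consts p `<=` consts q by []; exists pq => _ [psi hpsi <-].
  by left; rewrite /sen_tr Delta_incl_id sen_subst_id.
by exists q, h; right; rewrite /le_tr /sen_tr Delta_incl_id sen_subst_id.
Qed.

Hypothesis hC : forall s : sorts Sg, [set: C s] #= [set: nat].

(** The variables [X] become fresh constants of [C], and merging the two layers of constants turns
    the consistent theory into a condition. *)
Lemma extend_constants p n (X : 'I_n -> sorts (Delta_of p))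
    (G : set (sen (extv (Delta_of p) X))) :
  ~ entails (upv X @` axs p `|` G) [set bot] ->
  exists q (h : cond_le p q)
    (th : forall s, vars X s -> term (Sg := Delta_of q) s),
    forall psi, G psi ->
      axs q (sen_subst (inst (C := vars (X : 'I_n -> sorts (Delta_of q))) th)
        (sen_subst (lift (subst_of_mor (Delta_incl (le_consts h))) X) psi)).
Proof.
move=> cons.
have [c [c_inj c_fresh]] := fresh_constants X hC (consts_finite p).
pose D := consts p.
pose E := D `|` range (fun i => existT C (X i) (c i)).
have finE : finite_set E.
  by rewrite finite_setU; split; [exact: consts_finite | exact: finite_image].
have DE : D `<=` E by move=> x; left.
pose b s (x : vars X s) : Delta_consts E s :=
  let: exist i e := x in
  match e in _ = s return Delta_consts E s with
  | erefl => exist _ (c i) (mem_set (or_intror (ex_intro2 _ _ i I erefl)))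
  end.
pose a := @Delta_incl_fun _ C _ _ DE.
have aE s x : D (existT C s (val (a s x))) by exact: set_mem (valP x).
have bE s (x : vars X s) :
    existT C s (val (b s x)) = existT C (X (sval x)) (c (sval x)).
  by case: x => i e; case: s / e.
have b_fresh s x : ~ D (existT C s (val (b s x))) by rewrite bE; exact: c_fresh.
(* Membership in [D] decides the layer of [y]: freshness keeps the layers disjoint, and injectivity
   of [c] recovers the variable. *)
have split_const s (y : Delta_consts E s) :
    exists z : Delta_consts D s + vars X s,
      (forall x, y = a s x -> z = inl x) /\ (forall x, y = b s x -> z = inr x).
  have [Dy|nDy] := pselect (D (existT C s (val y))).
    exists (inl (exist _ (val y) (mem_set Dy))); split=> x yE.
      by congr inl; apply: val_inj; rewrite /= yE.
    by case: (@b_fresh s x); rewrite -yE.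
  have [//|[i _ iE]] := set_mem (valP y).
  have e : X i = s := congr1 (@projT1 _ _) iE.
  exists (inr (exist _ i e)); split=> x yE; first by case: nDy; rewrite yE.
  congr inr; move: yE (bE s x) iE => <- -> /c_inj.
  case: x => j e' /= ij; case: j / ij e' => e'.
  by congr exist; exact: Prop_irrelevance.
pose d s y := sval (cid (split_const s y)).
have da s x : d s (a s x) = inl x.
  exact: (svalP (cid (split_const s (a s x)))).1.
have db s x : d s (b s x) = inr x.
  exact: (svalP (cid (split_const s (b s x)))).2.
pose q := Condition finE (merge_consistent da db cons).
have incl_merge :
    comp_subst (subst_of_mor (ext_incl (vars X))) (subst_of_mor (merge a b)) =
    subst_of_mor (Delta_incl DE).
  by apply: subst_ext => m w s [].
have h : cond_le p q.
  exists (DE : consts p `<=` consts q) => _ [psi hpsi <-].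
  exists (upv X psi); first by left; exists psi.
  by rewrite /sen_tr sen_subst_comp incl_merge.
exists q, h, (fun s x => Defs.cst (C := Delta_consts E) (b s x)) => psi Gpsi.
exists psi; first by right.
(* [merge] sends a variable to a symbol, [inst] to the term of that symbol; the two agree once
   normalized. *)
rewrite /sen_tr sen_subst_comp -[LHS]sen_subst_norm -[RHS]sen_subst_norm.
congr sen_subst; apply: subst_ext => -[|m] w s [[f|x]|x] //=.
  by rewrite (Prop_irrelevance (le_consts h) DE).
rewrite (App_cst (C := Delta_consts E) w (b s x)).
congr inr; congr (Defs.cst (C := Delta_consts E) (b s _)); case: x => i e /=.
by congr exist; exact: Prop_irrelevance.
Qed.

(** * Forcing *)

Definition le_term p q (h : cond_le p q) (s : sorts Sg)
    (t : term (Sg := Delta_of p) s) : term (Sg := Delta_of q) s :=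
  term_tr (Delta_incl (le_consts h)) t.

Lemma le_term_comp p q r (hpq : cond_le p q) (hqr : cond_le q r)
    (hpr : cond_le p r) s (t : term (Sg := Delta_of p) s) :
  le_term hqr (le_term hpq t) = le_term hpr t.
Proof.
elim: t => n w s' f ts IH.
case: f => [f|x]; rewrite /le_term /term_tr /=.
  congr App; apply: functional_extensionality_dep => i; exact: IH.
congr (@App (Delta_of r) n w s' _ _).
  by congr inr; case: n w ts IH x => //= w ts IH x; apply: val_inj.
by apply: functional_extensionality_dep => i; exact: IH.
Qed.

Lemma le_tr_Tr p q (h : cond_le p q) s a (t1 t2 : term (Sg := Delta_of p) s) :
  le_tr h (Tr a t1 t2) = Tr (Sg := Delta_of q) a (le_term h t1) (le_term h t2).
Proof. by rewrite /le_tr /sen_tr /= act_map_id. Qed.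

(** Forcing of transitions persists upwards, since axioms do and intermediate terms can be
    translated. *)
Lemma forces_tr_le p q (h : cond_le p q) s a
    (t1 t2 : term (Sg := Delta_of p) s) :
  forces p (Tr a t1 t2) ->
  forces q (Tr (Sg := Delta_of q) a (le_term h t1) (le_term h t2)).
Proof.
elim: a t1 t2 => [l|a IHa b IHb|a IHa b IHb|a IHa] t1 t2.
- by rewrite !forces_Lbl => -[/(le_axs_tr h) ax _]; split.
- move=> /forces_Comp [t [/IHa Ha /IHb Hb]].
  by apply/forces_Comp; exists (le_term h t).
- by move=> /forces_Cup [/IHa|/IHb] H; apply/forces_Cup; [left|right].
- move=> /forces_Star [[|n] H]; apply/forces_Star.
    by exists 0; case: H => /(le_axs_tr h) ax _; split.
  exists n.+1; elim: n t1 t2 H => [|n IHn] t1 t2 /=; first exact: IHa.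
  move=> /forces_Comp [t [/IHa Ha /IHn Hn]].
  by apply/forces_Comp; exists (le_term h t).
Qed.

(** Each forcing clause for actions mirrors an introduction rule. *)
Lemma forces_tr_entails p s a (t1 t2 : term (Sg := Delta_of p) s) :
  forces p (Tr a t1 t2) -> entails (axs p) [set Tr a t1 t2].
Proof.
elim: a t1 t2 => [l|a IHa b IHb|a IHa b IHb|a IHa] t1 t2.
- by case=> ax _; exact: entails_ax.
- by move=> /forces_Comp [t [/IHa Ha /IHb Hb]]; exact: Comp_I Ha Hb.
- by move=> /forces_Cup [/IHa|/IHb]; [exact: Union_I1 | exact: Union_I2].
- move=> /forces_Star [n H]; apply: (@Star_I _ _ _ _ _ _ n).
  case: n H => [[ax _]|n /=]; first exact: entails_ax.
  elim: n t1 t2 => [|n IHn] t1 t2 /=; first exact: IHa.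
  by move=> /forces_Comp [t [/IHa Ha /IHn Hn]]; exact: Comp_I Ha Hn.
Qed.

(** * Forcing provable sentences in stronger conditions *)

(** The premise is an elimination rule with conclusion [bot]. If every case were refutable, [p]
    would be inconsistent, so some case can be added as an axiom. *)
Lemma extend_case p (I : Type) (F : I -> sen (Delta_of p)) :
  ((forall i, entails (axs p `|` [set F i]) [set bot]) ->
    entails (axs p) [set bot]) ->
  exists i q (h : cond_le p q), axs q (le_tr h (F i)).
Proof.
move=> H; apply: contrapT => none; apply: (axs_consistent (c := p)).
apply: H => i; apply: contrapT => /extend_axiom [q [h ax]].
by apply: none; exists i, q, h.
Qed.

Definition entailed_forced (a : action (labels Sg)) : Prop :=
  forall p s (t1 t2 : term (Sg := Delta_of p) s),
  entails (axs p) [set Tr (Sg := Delta_of p) a t1 t2] ->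
  exists q (h : cond_le p q),
    forces q (Tr (Sg := Delta_of q) a (le_term h t1) (le_term h t2)).

Lemma entailed_forced_Comp a b :
  entailed_forced a -> entailed_forced b -> entailed_forced (Comp a b).
Proof.
move=> Ha Hb p s t1 t2 ent.
have /extend_constants [q [pq [th ax]]] :
    ~ entails (upv (var1 (Sg := Delta_of p) s) @` axs p `|`
      [set Tr (Sg := extv (Delta_of p) (var1 s)) a (uptv (var1 s) t1) (x1 s);
           Tr (Sg := extv (Delta_of p) (var1 s)) b (x1 s) (uptv (var1 s) t2)])
      [set bot].
  by move=> /(@Comp_E _ _ _ _ _ _ _ bot ent); exact: axs_consistent.
(* [u] is the fresh constant that names the midpoint of the composition. *)
pose u := term_subst (inst (Sg := Delta_of q) th)
  (term_subst (lift (subst_of_mor (Delta_incl (le_consts pq))) (var1 s))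
    (x1 s)).
have upE (t : term (Sg := Delta_of p) s) :
    term_subst (inst (Sg := Delta_of q) th)
      (term_subst (lift (subst_of_mor (Delta_incl (le_consts pq))) (var1 s))
        (uptv (var1 s) t)) = le_term pq t.
  by rewrite /term_tr term_lift_incl; exact: term_inst_incl.
have /= := ax _ (or_introl erefl); rewrite !act_map_id upE => /entails_ax.
have /= := ax _ (or_intror erefl); rewrite !act_map_id upE => /entails_ax.
rewrite -/u => entb /Ha [r [qr Fa]].
(* The second step is treated above [r], where the first is already forced; persistence then carries
   the first up to [r']. *)
have /Hb [r' [rr' Fb]] : entails (axs r)
    [set Tr (Sg := Delta_of r) b (le_term qr u) (le_term qr (le_term pq t2))].
  by rewrite -le_tr_Tr; exact: entails_le.
have pr := cond_le_trans pq qr; have pr' := cond_le_trans pr rr'.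
exists r', pr'; apply/forces_Comp; exists (le_term rr' (le_term qr u)).
rewrite -(le_term_comp pr rr' pr' t1) -(le_term_comp pq qr pr t1).
rewrite -(le_term_comp pr rr' pr' t2) -(le_term_comp pq qr pr t2).
by split=> //; exact: forces_tr_le.
Qed.

Lemma entailed_forced_act a : entailed_forced a.
Proof.
elim: a => [l|a IHa b IHb|a IHa b IHb|a IHa].
- move=> p s t1 t2 ent.
  have /extend_axiom [q [h ax]] :
      ~ entails (axs p `|` [set Tr (Sg := Delta_of p) (Lbl l) t1 t2]) [set bot].
    by move=> /(entails_cut ent); exact: axs_consistent.
  by exists q, h; split.
- exact: entailed_forced_Comp.
- move=> p s t1 t2 ent.
  have [|c [q [pq /entails_ax]]] := @extend_case p bool
      (fun c => Tr (Sg := Delta_of p) (if c then a else b) t1 t2).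
    by move=> H; apply: Union_E ent (H true) (H false).
  rewrite le_tr_Tr => entq.
  have [r [qr F]] : exists r (qr : cond_le q r), forces r (Tr (Sg := Delta_of r)
      (if c then a else b) (le_term qr (le_term pq t1))
      (le_term qr (le_term pq t2))).
    by case: c entq => [/IHa|/IHb].
  exists r, (cond_le_trans pq qr).
  move: F; rewrite !(le_term_comp _ _ (cond_le_trans pq qr)) => F.
  by apply/forces_Cup; case: c F {entq}; [left|right].
(* Powers of [a] are not subterms of [Star a], so they are obtained from [a] by the composition
   lemma. *)
- have IHn n : entailed_forced (act_powS a n).
    by elim: n => [//|n IHn]; exact: entailed_forced_Comp.
  move=> p s t1 t2 ent.
  have [|n [q [pq ax]]] := @extend_case p nat
      (fun n => Tr_pow (Sg := Delta_of p) a n t1 t2).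
    by move=> H; apply: Star_E ent H.
  case: n ax => [|n] ax.
    by exists q, pq; apply/forces_Star; exists 0; split.
  have /IHn [r [qr F]] : entails (axs q) [set Tr (Sg := Delta_of q)
      (act_powS a n) (le_term pq t1) (le_term pq t2)].
    by rewrite -le_tr_Tr; exact: entails_ax.
  exists r, (cond_le_trans pq qr); apply/forces_Star; exists n.+1.
  by move: F; rewrite !(le_term_comp _ _ (cond_le_trans pq qr)).
Qed.

(** Instantiating over [q] and then moving to [r] amounts to moving to [r] first and instantiating
    with the translated witnesses. *)
Lemma lift_inst_le p q r (pq : cond_le p q) (qr : cond_le q r)
    (pr : cond_le p r) n (X : 'I_n -> sorts Sg)
    (th : forall s, vars X s -> term (Sg := Delta_of q) s) :
  comp_subst (lift (subst_of_mor (Delta_incl (le_consts pq))) X)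
    (comp_subst (inst (Sg := Delta_of q) th)
      (subst_of_mor (Delta_incl (le_consts qr)))) =
  comp_subst (lift (subst_of_mor (Delta_incl (le_consts pr))) X)
    (inst (Sg := Delta_of r) (fun s x => le_term qr (th s x))).
Proof.
apply: subst_ext => m w s [[f|x]|x] //=.
  congr inl; congr inr; case: m w x => //= w x; exact: val_inj.
by congr inr; case: m w x.
Qed.

(** Both claims are proved together because negation swaps them. The induction is on a bound for the
    depth, which translations and instantiations preserve. *)
Lemma forcing_sound_complete k p (phi : sen (Delta_of p)) : depth phi <= k ->
  (forces p phi -> entails (axs p) [set phi]) /\
  (entails (axs p) [set phi] ->
    exists q (h : cond_le p q), forces q (le_tr h phi)).
Proof.
elim: k p phi => [|k IH] p [s t1 t2|s a t1 t2|psi|Phi|n X psi] //= dk.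
(* Equations and transitions have depth 0, so each occurs twice, for [k = 0] and for a successor. *)
1,3: split=> [[ax _]|ent]; first exact: entails_ax.
1,2: have /extend_axiom [q [h ax]] :
      ~ entails (axs p `|` [set Eq t1 t2]) [set bot];
    by [move=> /(entails_cut ent); exact: axs_consistent | exists q, h; split].
1,2: split=> [|/entailed_forced_act [q [h F]]]; first exact: forces_tr_entails.
1,2: by exists q, h; rewrite le_tr_Tr.
- split=> [F|ent].
    (* Were [psi] consistent with [axs p], completeness for [psi] would give a condition above [p]
       forcing it, against [F]. *)
    apply: Neg_I; apply: contrapT => /extend_axiom [q [pq /entails_ax]].
    move=> /(IH q _ _).2 []; first by rewrite depth_subst.
    move=> r [qr]; rewrite (le_tr_comp _ _ (cond_le_trans pq qr)).
    by move/forces_Neg: F; apply.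
  (* Here [p] itself forces the negation: a stronger [q] forcing [psi] would prove it by soundness
     and be inconsistent. *)
  exists p, (cond_le_refl p); rewrite le_tr_id; apply/forces_Neg => q pq F.
  apply: (axs_consistent (c := q)).
  apply: (entails_absurd _ (entails_le pq ent)).
  by apply: (IH q _ _).1; rewrite ?depth_subst.
- split=> [/forces_Disj [psi [inPhi F]]|ent].
    apply: Disj_I (inPhi); apply: (IH p _ _).1 F.
    by rewrite -ltnS (leq_trans (depth_Disj inPhi)).
  have [|[psi inPhi] [q [pq /entails_ax]]] := @extend_case p
      {psi | List.In psi Phi} (fun psi => sval psi).
    by move=> H; apply: Disj_E ent _ => psi inPhi;
      exact: (H (exist _ psi inPhi)).
  move=> /(IH q _ _).2 [].
    by rewrite depth_subst -ltnS (leq_trans (depth_Disj inPhi)).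
  move=> r [qr]; rewrite (le_tr_comp _ _ (cond_le_trans pq qr)) /= => F.
  exists r, (cond_le_trans pq qr); apply/forces_Disj.
  by exists (le_tr (cond_le_trans pq qr) psi); split=> //; exact: List.in_map.
- split=> [/forces_Ex [th F]|ent].
    apply: (@Rule_Subst _ _ _ _ _ th); apply: (IH p _ _).1 F.
    by rewrite depth_subst.
  have /extend_constants [q [pq [th ax]]] :
      ~ entails (upv X @` axs p `|` [set psi]) [set bot].
    (* [Quant_I] with conclusion [bot], read backwards: a provable existential may be given a fresh
       witness. *)
    move=> /(@Quant_I _ _ _ _ _ bot) /(entails_cut ent).
    exact: axs_consistent.
  have /entails_ax /(IH q _ _).2 [] := ax _ erefl.
    by rewrite !depth_subst.
  move=> r [qr F]; have pr := cond_le_trans pq qr; exists r, pr.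
  apply/forces_Ex; exists (fun s x => le_term qr (th s x)).
  move: F; rewrite /le_tr /sen_tr !sen_subst_comp.
  by rewrite (lift_inst_le pq qr pr).
Qed.

End Conditions.

Theorem theorem5p1 (Sg : signature) (C : sorts Sg -> Type)
    (hSg : countable_signature Sg)
    (hC : forall s : sorts Sg, [set: C s] #= [set: nat])
    (p : condition C) (phi : sen (Delta_of p)) :
  weak_forces p phi <-> entails (axs p) [set phi].
Proof.
have snd q psi := (@forcing_sound_complete _ _ hC _ q psi (leqnn _)).1.
have cpl q psi := (@forcing_sound_complete _ _ hC _ q psi (leqnn _)).2.
rewrite /weak_forces; split=> [F|ent].
  apply: entails_contra; apply: contrapT => /extend_axiom [q [pq /entails_ax]].
  (* It suffices that [q] forces the negation of [phi]: any [r] above [q] forcing [phi] would prove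
     it, yet [r] inherits the axiom [Neg phi]. *)
  move=> nphi; apply: ((forces_Neg _).1 F q pq); apply/forces_Neg => r qr.
  move=> /snd; rewrite -/(le_tr qr _) => ent.
  exact: axs_consistent (entails_absurd ent (entails_le qr nphi)).
apply/forces_Neg => q pq /forces_Neg F.
(* [q] still proves [phi], so some [r] above [q] forces it, and [q] cannot force its negation. *)
have [r [qr]] := cpl _ _ (entails_le pq ent).
exact: F.
Qed.
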